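(* Let $X,Y$ be finite-dimensional spaces, $C\subset X$ closed convex, $h:X\to\mathbb R$, $g:X\to Y$, and let $L(x,y)=h(x)+\langle g(x),y\rangle$. Suppose that the nonlinear program $$\min_{x\in C}h(x)\quad\text{subject to } g(x)=0$$ has an optimal (primal-dual) solution $\bar z=(\bar x,\bar y)\in X\times Y$ such that the set-valued mapping $$(x,y)\mapsto\begin{pmatrix}\nabla h(x)+\nabla g(x)^*y\\ g(x)\end{pmatrix}+N_C(x)\times\{0\}$$ is strongly regular at $(\bar x,\bar y)$ for $0$, and suppose that the Hessian update $B_{k+1}=\Psi(B_k,z_k)$ is locally input-to-state stable around $\nabla^2L(\bar x,\bar y)$ (with state $B_k$ and input $z_k-\bar z$). Consider the quasi-Newton step in which $z_{k+1}=(x_{k+1},y_{k+1})$ is the primal-dual solution of the quadratic program $$\min_{x\in C}\ \tfrac12\langle B_{k+1}(x-x_k),x-x_k\rangle+\nabla h(x_k)(x-x_k)\quad\text{subject to } g(x_k)+\nabla g(x_k)(x-x_k)=0.$$ Then the quasi-Newton step together with the Hessian update $B_{k+1}=\Psi(B_k,z_k)$ is locally asymptotically stable, i.e. the pair $(z_k,B_{k+1})$ is locally asymptotically stable at $(\bar z,\nabla^2L(\bar x,\bar y))$.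
   Context: Here $\nabla^2L$ denotes the Hessian of $L$ with respect to $x$; $h$ and $g$ are continuously differentiable with $\nabla^2L$ existing, and by convention every gradient (derivative) that exists is assumed Lipschitz continuous around the point of interest. $Y$ is identified with its dual. The matrices $B_{k+1}$ are (symmetric) positive definite approximations of the Hessian of the Lagrangian, and the primal-dual solution of the quadratic program is taken to be unique (locally, near $\bar z$). $N_C(\bar x)=\{u\in X^*:\langle u,x-\bar x\rangle\le0\ \forall x\in C\}$ if $\bar x\in C$, and $\varnothing$ otherwise. A set-valued map $G$ with $(\bar a,\bar b)\in\operatorname{graph}G$ is strongly regular at $\bar a$ for $\bar b$ if there are neighbourhoods $U$ of $\bar a$ and $W$ of $\bar b$ and a Lipschitz continuous function $s$ on $W$ such that $G^{-1}(b)\cap U=\{s(b)\}$ for all $b\in W$. A system $w_{k+1}=\Phi(w_k,u_k)$ is locally input-to-state stable around $\bar w$ if there exist $\epsilon,\delta>0$, $\beta\in\mathcal{KL}$, $\gamma\in\mathcal K_\infty$ such that any sequence generated under $\|\mathbf u\|_\infty=\sup_k\|u_k\|<\delta$ with $\|w_0-\bar w\|<\epsilon$ satisfies $\|w_k-\bar w\|\le\beta(\|w_0-\bar w\|,k)+\gamma(\|\mathbf u\|_\infty)$ for all $k\in\mathbb N$. Local asymptotic stability of an equilibrium is meant in the usual (Lyapunov) sense: stability together with local attractivity. *)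

(* Defs.v *)
From HB Require Import structures.
From mathcomp Require Import all_boot all_order all_algebra.
From mathcomp Require Import all_classical all_reals all_analysis.

Set Implicit Arguments.
Unset Strict Implicit.
Unset Printing Implicit Defensive.

Import Order.TTheory GRing.Theory Num.Theory.
Import numFieldNormedType.Exports.

Local Open Scope classical_set_scope.
Local Open Scope ring_scope.

(* The finite-dimensional spaces are R^n and R^m as row vectors, identified with their duals through
   the dot product; a linear map acts on row vectors by right multiplication,
   so that ['d g x v = v *m 'J g x] and the adjoint of ['d g x] is
   [y |-> y *m ('J g x)^T]. *)

Definition dot (R : realType) (n : nat) (u v : 'rV[R]_n) : R :=
  \sum_(i < n) u 0 i * v 0 i.

Definition grad (R : realType) (n : nat) (f : 'rV[R]_n -> R) (x : 'rV[R]_n) :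
  'rV[R]_n := \row_i 'd f x (delta_mx 0 i).

Definition spd (R : realType) (n : nat) (B : 'M[R]_n) : Prop :=
  B^T = B /\ forall v : 'rV[R]_n, v != 0 -> 0 < dot (v *m B) v.

Definition lipschitz_around (R : realType) (V W : normedModType R)
    (f : V -> W) (a : V) : Prop :=
  exists2 U : set V, nbhs a U & [lipschitz f x | x in U].

Definition normal_cone (R : realType) (n : nat) (C : set 'rV[R]_n)
    (x : 'rV[R]_n) : set 'rV[R]_n :=
  [set u | C x /\ forall x', C x' -> dot u (x' - x) <= 0].

(* [b \in G a] is written [G a b]. *)
Definition strongly_regular (R : realType) (V W : normedModType R)
    (G : V -> set W) (a : V) (b : W) : Prop :=
  G a b /\
  exists (U : set V) (N : set W) (s : W -> V),
    [/\ nbhs a U, nbhs b N, [lipschitz s b' | b' in N] &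
        forall b', N b' -> [set a' | G a' b'] `&` U = [set s b']].

Section Program.
Context (R : realType) (n m : nat).
Implicit Types (C : set 'rV[R]_n) (f h : 'rV[R]_n -> R)
  (g : 'rV[R]_n -> 'rV[R]_m) (z : 'rV[R]_n * 'rV[R]_m).

Definition lagrangian h g (x : 'rV[R]_n) (y : 'rV[R]_m) : R :=
  h x + dot (g x) y.

Definition grad_lagrangian h g z : 'rV[R]_n :=
  grad (fun x => lagrangian h g x z.2) z.1.

Definition hess_lagrangian h g z : 'M[R]_n :=
  'J (fun x => grad_lagrangian h g (x, z.2)) z.1.

Definition kkt_map C f g z : set ('rV[R]_n * 'rV[R]_m) :=
  [set (grad f z.1 + z.2 *m ('J g z.1)^T, g z.1) + v
    | v in normal_cone C z.1 `*` [set 0]].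

(* Solutions of  min f(x)  subject to  x in C, g(x) = 0:  the primal part is a
   minimizer and the dual part a Lagrange multiplier for it.  Feasibility of
   [z.1] is part of [kkt_map C f g z 0]. *)
Definition primal_dual_solution C f g z : Prop :=
  (forall x, C x -> g x = 0 -> f z.1 <= f x) /\ kkt_map C f g z 0.

Definition qp_objective h (xk : 'rV[R]_n) (B : 'M[R]_n) (x : 'rV[R]_n) : R :=
  2^-1 * dot ((x - xk) *m B) (x - xk) + 'd h xk (x - xk).

Definition qp_constraint g (xk x : 'rV[R]_n) : 'rV[R]_m :=
  g xk + 'd g xk (x - xk).

(* The state [w] is (z_k, B_{k+1}), its successor [w'] is (z_{k+1}, B_{k+2}):
   z_{k+1} is the unique primal-dual solution of the quadratic program at x_k
   with matrix B_{k+1}, and B_{k+2} = Psi(B_{k+1}, z_{k+1}). *)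
Definition quasi_newton_step C h g
    (Psi : 'M[R]_n -> 'rV[R]_n * 'rV[R]_m -> 'M[R]_n)
    (w w' : ('rV[R]_n * 'rV[R]_m) * 'M[R]_n) : Prop :=
  unique (primal_dual_solution C (qp_objective h w.1.1 w.2)
            (qp_constraint g w.1.1)) w'.1 /\
  w'.2 = Psi w.2 w'.1.

End Program.

(* Comparison functions are only constrained on [0, +oo[. *)
Definition class_K (R : realType) (a : R -> R) : Prop :=
  [/\ {within `[0, +oo[%classic, continuous a},
      {in `[0, +oo[ &, {homo a : r s / r < s}} & a 0 = 0].

Definition class_Koo (R : realType) (a : R -> R) : Prop :=
  class_K a /\ a r @[r --> +oo] --> +oo.

Definition class_KL (R : realType) (b : R -> R -> R) : Prop :=
  (forall t, 0 <= t -> class_K (b ^~ t)) /\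
  (forall r, 0 <= r ->
     {in `[0, +oo[ &, {homo b r : s t / s <= t >-> t <= s}} /\
     b r t @[t --> +oo] --> 0).

(* [sup] is meaningful only for bounded sequences; boundedness is required
   separately wherever [sup_norm] occurs. *)
Definition sup_norm (R : realType) (V : normedModType R) (u : nat -> V) : R :=
  sup (range (fun k => `|u k|)).

(* [D] is the state space, a subset of [W]. *)
Definition locally_ISS (R : realType) (W U : normedModType R) (D : set W)
    (Phi : W -> U -> W) (wbar : W) : Prop :=
  exists (e d : R) (b : R -> R -> R) (c : R -> R),
    [/\ 0 < e, 0 < d, class_KL b, class_Koo c &
      forall (w : nat -> W) (u : nat -> U),
        D (w 0%N) -> (forall k, w k.+1 = Phi (w k) (u k)) ->
        `|w 0%N - wbar| < e ->
        has_ubound (range (fun k => `|u k|)) -> sup_norm u < d ->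
        forall k, `|w k - wbar| <= b `|w 0%N - wbar| k%:R + c (sup_norm u)].

Definition trajectory (T : Type) (D : set T) (step : T -> T -> Prop)
    (w : nat -> T) : Prop :=
  (forall k, D (w k)) /\ (forall k, step (w k) (w k.+1)).

(* Lyapunov stability and local attractivity for the system on the state space
   [D] given by a transition relation; the first clause (every nearby state
   starts a trajectory) keeps the other two from being vacuous.  If [D wbar],
   the first two clauses force [step wbar wbar]; [wbar] may also be a boundary
   point of [D], e.g. a singular Hessian approached by definite matrices. *)
Definition locally_asymptotically_stable (R : realType) (W : normedModType R)
    (D : set W) (step : W -> W -> Prop) (wbar : W) : Prop :=
  [/\ exists2 d : R, 0 < d & forall w0, D w0 -> `|w0 - wbar| < d ->
        exists2 w, trajectory D step w & w 0%N = w0,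
      forall e : R, 0 < e -> exists2 d : R, 0 < d &
        forall w, trajectory D step w -> `|w 0%N - wbar| < d ->
          forall k, `|w k - wbar| < e &
      exists2 d : R, 0 < d &
        forall w, trajectory D step w -> `|w 0%N - wbar| < d ->
          w @ \oo --> wbar].

(* Main.v *)
Require Import Defs.
From mathcomp Require Import all_boot all_order all_algebra.
From mathcomp Require Import ring lra.
From mathcomp Require Import all_classical all_reals all_analysis.
Import Order.TTheory GRing.Theory Num.Theory.
Import numFieldNormedType.Exports.
Local Open Scope classical_set_scope.
Local Open Scope ring_scope.

(** Let [H] be the Hessian of the Lagrangian at [zbar].  The proof combines a
    contraction estimate for one quasi-Newton step with a loop argument for the
    coupled dynamics of the iterates and the matrices.

    One step.  The optimality system of the quadratic program at [(x_k, B)] and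
    that of the nonlinear program share the normal cone, so they differ by a
    function, the residual.  Its Lipschitz constant near [zbar] is controlled by
    [B - H] and by the oscillation of the second derivative of the Lagrangian in
    [x] and of ['J g], hence is arbitrarily small near the reference state
    ([qn_residual_lipschitz]).  Strong regularity survives such a perturbation
    ([strongly_regular_perturbation]): the quadratic program has exactly one
    Karush-Kuhn-Tucker point [z] near [zbar], at a distance of at most a fixed
    multiple of the residual at [zbar].  The residual vanishes at
    [(x_k, zbar.2)], so its value at [zbar] is at most a small constant times
    [`|x_k - zbar.1|], and
    [`|z - zbar| <= 1/2 * `|z_k - zbar|] ([qn_step_solvable]).  The quadratic
    program being strictly convex with a convex set of multipliers, this point is
    its only primal-dual solution globally ([kkt_qp_unique_solution]), so the step
    is well defined and is the contraction just described.

    The loop.  The contraction holds as long as [B] is close to [H], while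
    input-to-state stability keeps [B] close to [H] as long as the inputs
    [z_k - zbar] are small, which the contraction ensures.  An induction on time
    shows that neither subsystem can be the first to leave its region
    ([cascade_confined]); then the iterates converge geometrically, and the
    matrices converge because their input tends to 0
    ([cascade_asymptotically_stable]). *)

Set Implicit Arguments.
Unset Strict Implicit.
Unset Printing Implicit Defensive.

(** * Maximum-norm estimates and a mean value inequality *)

Lemma mx_entry_le (R : realType) (p q : nat) (M : 'M[R]_(p, q)) i j :
  `|M i j| <= `|M|.
Proof.
rewrite [leRHS]/Num.norm /= mx_normrE.
exact: (le_bigmax _ (fun ij : 'I_p * 'I_q => `|M ij.1 ij.2|) (i, j)).
Qed.

Lemma mx_norm_le (R : realType) (p q : nat) (M : 'M[R]_(p, q)) (r : R) :
  0 <= r -> (forall i j, `|M i j| <= r) -> `|M| <= r.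
Proof.
move=> r0 Mr; rewrite [leLHS]/Num.norm /= mx_normrE.
by apply/bigmax_leP; split => // -[i j] _ /=.
Qed.

Lemma mx_norm_trmx (R : realType) (p q : nat) (M : 'M[R]_(p, q)) :
  `|M^T| <= `|M|.
Proof. by apply: mx_norm_le => // i j; rewrite mxE mx_entry_le. Qed.

Lemma mulmx_norm_le (R : realType) (n m : nat) (u : 'rV[R]_n)
  (M : 'M[R]_(n, m)) : `|u *m M| <= n%:R * `|u| * `|M|.
Proof.
apply: mx_norm_le => [|i j]; first by rewrite !mulr_ge0.
rewrite mxE (le_trans (ler_norm_sum _ _ _))//.
have -> : n%:R * `|u| * `|M| = \sum_(k < n) `|u| * `|M|.
  by rewrite sumr_const card_ord -mulrA mulr_natl.
by apply: ler_sum => k _; rewrite normrM ler_pM// mx_entry_le.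
Qed.

Lemma diffEjacobian (R : realType) (n m : nat) (f : 'rV[R]_n -> 'rV[R]_m) x v :
  'd f x v = v *m 'J f x.
Proof. by rewrite mul_rV_lin1. Qed.

Lemma prod_norm_lt (R : realType) (V W : normedModType R) (w : V * W) (e : R) :
  (`|w| < e) = (`|w.1| < e) && (`|w.2| < e).
Proof. by rewrite prod_normE gt_max. Qed.

Lemma prod_norm_le (R : realType) (V W : normedModType R) (w : V * W) (e : R) :
  (`|w| <= e) = (`|w.1| <= e) && (`|w.2| <= e).
Proof. by rewrite prod_normE ge_max. Qed.

(** The mean value theorem applied along the segment to each coordinate of
    [x |-> f x - x *m A]; the intermediate point depends on the coordinate,
    which is harmless because the bound on ['J f] is uniform.  The factor [n]
    comes from bounding a row-matrix product in the maximum norm. *)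
Lemma jacobian_mean_value (R : realType) (n m : nat)
    (f : 'rV[R]_n -> 'rV[R]_m) (A : 'M[R]_(n, m)) (e : R) (x y : 'rV[R]_n) :
    (forall t : R, 0 <= t <= 1 -> differentiable f (y + t *: (x - y)) /\
       `|'J f (y + t *: (x - y)) - A| <= e) ->
  `|f x - f y - (x - y) *m A| <= n%:R * `|x - y| * e.
Proof.
move=> fA.
have e0 : 0 <= e.
  by have [|_] := fA 0; [rewrite lexx ler01|exact: le_trans].
apply: mx_norm_le => [|i j]; first by rewrite !mulr_ge0.
rewrite (ord1 i) {i}.
pose p (t : R) : 'rV[R]_n := y + t *: (x - y).
pose psi (t : R) : 'rV[R]_m := f (p t) - t *: ((x - y) *m A).
pose dpsi (t : R) : 'rV[R]_m := (x - y) *m ('J f (p t) - A).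
have dp (t : R) : is_diff t p (fun s : R => s *: (x - y)).
  have := is_diffD (is_diff_cst y t) (is_diff_scalel t (x - y)).
  by rewrite add0r.
have dfp (t : R) : 0 <= t <= 1 -> is_derive t 1 psi (dpsi t).
  move=> t01; have [df _] := fA _ t01.
  have df' : is_diff (p t) f ('d f (p t)) by exact: DiffDef.
  have := @is_diffB _ _ _ _ _ _ _ t (is_diff_comp (dp t) df')
    (is_diff_scalel t ((x - y) *m A)).
  move=> [dpsi_ex dpsiE]; split; first exact: diff_derivable.
  rewrite deriveE// dpsiE !fctE /= !scale1r diffEjacobian.
  by rewrite /dpsi mulmxBr.
have dfj (t : R) : 0 <= t <= 1 ->
    is_derive t 1 (fun s : R => psi s 0 j) (dpsi t 0 j).
  move=> /dfp[dt dE]; split; first by have /derivable_mxP/(_ 0 j) := dt.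
  by rewrite -dE derive_mx// mxE.
have : exists2 c, c \in `[0, 1]%R &
    psi 1 0 j - psi 0 0 j = dpsi c 0 j * (1 - 0).
  apply: (@MVT_segment _ (fun s => psi s 0 j) (fun s => dpsi s 0 j)) => //.
    by move=> t; rewrite in_itv/= => /andP[t0 t1]; apply: dfj; rewrite !ltW.
  apply/continuous_in_subspaceT => t; rewrite inE/= in_itv/= => t01.
  apply/differentiable_continuous/derivable1_diffP.
  by have [] := dfj _ t01.
move=> [c]; rewrite in_itv/= => c01.
have [_ cA] := fA _ c01.
rewrite /psi /p !scale1r !scale0r subr0 addr0 subr0 mulr1 (addrC y) subrK => E.
have -> : (f x - f y - (x - y) *m A) 0 j = dpsi c 0 j.
  by rewrite -E !mxE addrAC.
rewrite (le_trans (mx_entry_le _ _ _))// (le_trans (mulmx_norm_le _ _))//.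
by rewrite ler_wpM2l// mulr_ge0.
Qed.

(** * Perturbation of strongly regular mappings *)

(** The displacement [`|x - f x|] attains its minimum on [K]; at a minimizer
    that is not fixed, moving to [f x] would shrink it by the factor [q].
    Compactness thus replaces the completeness used in Banach's theorem. *)
Lemma compact_contraction_fixpoint (R : realType) (V : normedModType R)
    (K : set V) (f : V -> V) (q : R) :
    compact K -> K !=set0 -> (forall x, K x -> K (f x)) -> 0 <= q < 1 ->
    (forall x y, K x -> K y -> `|f x - f y| <= q * `|x - y|) ->
  exists2 x, K x & f x = x.
Proof.
move=> cK K0 fK /andP[q0 q1] fq.
have cdist : {within K, continuous (fun x => `|x - f x|)}.
  apply/subspace_continuousP => x Kx; apply/cvgrPdist_lt => e e0.
  near=> y.
  have Ky : K y by near: y; exact: withinT.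
  apply: le_lt_trans (ler_dist_dist _ _) _.
  rewrite (_ : _ - _ = (x - y) - (f x - f y)); last first.
    by rewrite !opprD !opprK addrACA.
  apply: le_lt_trans (ler_normB _ _) _.
  have := fq _ _ Kx Ky.
  have : `|x - y| < e / 2.
    by near: y; apply: cvg_within; apply: cvgr_dist_lt; rewrite ?divr_gt0.
  have := normr_ge0 (x - y).
  nra.
have [x Kx xmin] := compact_EVT_min K0 cK cdist.
move: Kx; rewrite inE => Kx; exists x => //.
have [->//|fx] := eqVneq (f x) x.
have d0 : 0 < `|x - f x| by rewrite normr_gt0 subr_eq0 eq_sym.
have := le_trans (xmin _ (mem_set (fK _ Kx))) (fq _ _ Kx (fK _ Kx)).
by rewrite ler_pMl// leNgt q1.
Unshelve. all: by end_near. Qed.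

(** Robinson's implicit function theorem for generalized equations.  With [s]
    the localized inverse of [G], of Lipschitz constant [k], solving
    [b + E z \in G z] near [a] amounts to solving [z = s (b + E z)].  If [E] has
    Lipschitz constant [1 / (2 k)] the right-hand side is a 1/2-contraction, so
    the solution exists, is unique in the ball, and its distance to [a = s b] is
    at most twice [k * `|E a|]. *)
Lemma strongly_regular_perturbation (R : realType) (V W : normedModType R)
    (G : V -> set W) (a : V) (b : W) :
    (forall r : R, compact [set z | `|z - a| <= r]) ->
    strongly_regular G a b ->
  exists2 k : R, 0 < k & exists2 r0 : R, 0 < r0 &
    forall (r : R) (E : V -> W), 0 < r <= r0 ->
      (forall z z', `|z - a| <= r -> `|z' - a| <= r ->
         `|E z - E z'| <= (2 * k)^-1 * `|z - z'|) ->
      2 * k * `|E a| <= r ->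
    exists z, [/\ `|z - a| <= 2 * k * `|E a|, G z (b + E z) &
      forall z', `|z' - a| <= r -> G z' (b + E z') -> z' = z].
Proof.
move=> cV [Gab [U [N [s [Ua Nb /pinfty_ex_gt0[k k0 lips] Gs]]]]].
have Es z b' : U z -> N b' -> G z b' -> z = s b'.
  by move=> Uz Nb' Gz; have : [set s b'] z by rewrite -Gs.
have sN b' : N b' -> G (s b') b' /\ U (s b').
  by move=> Nb'; have : [set s b'] (s b') by []; rewrite -Gs.
have sb : s b = a by apply/esym/Es => //; exact: nbhs_singleton.
have sL b1 b2 : N b1 -> N b2 -> `|s b1 - s b2| <= k * `|b1 - b2|.
  by move=> N1 N2; exact: (lips (b1, b2)).
exists k => //.
have [r1 /= r1_gt0 Ur1] := (nbhs_normP a U).1 Ua.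
have [r2 /= r2_gt0 Nr2] := (nbhs_normP b N).1 Nb.
exists (Num.min (r1 / 2) (k * (r2 / 2))).
  by rewrite lt_min !mulr_gt0// invr_gt0.
move=> r E /andP[r_gt0]; rewrite le_min => /andP[rr1 rr2] EL Ea.
have k2 : 0 < 2 * k by rewrite mulr_gt0.
have aa : `|a - a| <= r by rewrite subrr normr0 ltW.
have Er z : `|z - a| <= r -> `|E z| <= `|E a| + (2 * k)^-1 * `|z - a|.
  move=> zr; rewrite -[E z](subrK (E a)) addrC.
  by rewrite (le_trans (ler_normD _ _))// lerD2l EL.
(* [r0] is chosen so that [E] maps the ball into the neighbourhood where [s]
   is defined: there [`|E z| <= r / (2 k) + r / (2 k)]. *)
have EN z : `|z - a| <= r -> N (b + E z).
  move=> zr; apply: Nr2 => /=; rewrite opprD addNKr normrN.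
  rewrite (le_lt_trans (Er _ zr))//.
  apply: (@le_lt_trans _ _ (r / k)); last first.
    rewrite ltr_pdivrMr// (le_lt_trans rr2)// mulrC ltr_pM2r//.
    by rewrite ltr_pdivrMr// ltr_pMr// ltr1n.
  have : (2 * k)^-1 * `|z - a| <= (2 * k)^-1 * r by rewrite ler_pM2l ?invr_gt0.
  have : `|E a| <= (2 * k)^-1 * r by rewrite mulrC ler_pdivlMr// mulrC.
  have -> : r / k = (2 * k)^-1 * r + (2 * k)^-1 * r.
    by field; rewrite gt_eqF.
  exact: lerD.
have sEa z : `|z - a| <= r ->
    `|s (b + E z) - a| <= k * (`|E a| + (2 * k)^-1 * `|z - a|).
  move=> zr; rewrite -sb (le_trans (sL _ _ (EN _ zr) (nbhs_singleton Nb)))//.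
  by rewrite addrC addKr sb ler_pM2l// Er.
have half x : k * (`|E a| + (2 * k)^-1 * x) = (2 * k * `|E a| + x) / 2.
  by field; rewrite gt_eqF.
have [z zr zE] : exists2 z, `|z - a| <= r & s (b + E z) = z.
  apply: (@compact_contraction_fixpoint _ _ [set z | `|z - a| <= r]
    (fun z => s (b + E z)) 2^-1).
  - exact: cV.
  - by exists a.
  - move=> x /= xr; rewrite (le_trans (sEa _ xr))// half.
    by rewrite ler_pdivrMr// mulr2n mulrDr mulr1 lerD.
  - by rewrite invr_ge0 ler0n invf_lt1// ltr1n.
  - move=> x y /= xr yr; rewrite (le_trans (sL _ _ (EN _ xr) (EN _ yr)))//.
    rewrite opprD addrACA subrr add0r.
    rewrite (le_trans (ler_wpM2l (ltW k0) (EL _ _ xr yr)))//.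
    by rewrite mulrA invfM mulrCA mulfV ?gt_eqF// mulr1.
have := sEa _ zr; rewrite half zE => za.
exists z; split.
- lra.
- by have [] := sN _ (EN _ zr); rewrite zE.
- move=> z' z'r Gz'.
  have Uz' : U z'.
    apply: Ur1 => /=; rewrite distrC (le_lt_trans z'r)// (le_lt_trans rr1)//.
    by rewrite ltr_pdivrMr// ltr_pMr// ltr1n.
  have z'E := Es _ _ Uz' (EN _ z'r) Gz'.
  apply/eqP; rewrite -subr_eq0 -normr_le0 {1}z'E -{1}zE.
  have := sL _ _ (EN _ z'r) (EN _ zr); rewrite opprD addrACA subrr add0r.
  have := ler_wpM2l (ltW k0) (EL _ _ z'r zr).
  rewrite mulrA invfM mulrCA mulfV ?gt_eqF// mulr1 -z'E zE.
  lra.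
Qed.

(** * Calculus of gradients and Jacobian matrices *)

Section Dot.
Context (R : realType) (n : nat).
Implicit Types u v w : 'rV[R]_n.

Lemma dotE u v : dot u v = (u *m v^T) 0 0.
Proof. by rewrite mxE; apply: eq_bigr => i _; rewrite mxE. Qed.

Lemma dotC u v : dot u v = dot v u.
Proof. by apply: eq_bigr => i _; rewrite mulrC. Qed.

Lemma dotDl u v w : dot (u + v) w = dot u w + dot v w.
Proof. by rewrite !dotE mulmxDl mxE. Qed.

Lemma dotZl (a : R) u w : dot (a *: u) w = a * dot u w.
Proof. by rewrite !dotE -scalemxAl mxE. Qed.

Lemma dotNl u w : dot (- u) w = - dot u w.
Proof. by rewrite -scaleN1r dotZl mulN1r. Qed.

Lemma dotDr u v w : dot w (u + v) = dot w u + dot w v.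
Proof. by rewrite dotC dotDl !(dotC w). Qed.

End Dot.

Lemma dot_mulmx_tr (R : realType) (n m : nat) (v : 'rV[R]_n) (y : 'rV[R]_m)
  (A : 'M[R]_(n, m)) : dot (v *m A) y = dot v (y *m A^T).
Proof. by rewrite !dotE trmx_mul trmxK mulmxA. Qed.

Lemma diffEgrad (R : realType) (n : nat) (f : 'rV[R]_n -> R) x v :
  'd f x v = dot (grad f x) v.
Proof.
rewrite [in LHS](row_sum_delta v) linear_sum /=.
by apply: eq_bigr => i _; rewrite linearZ/= mxE mulrC.
Qed.

Lemma grad_unique (R : realType) (n : nat) (f df : 'rV[R]_n -> R) x u :
  is_diff x f df -> (forall v, df v = dot u v) -> grad f x = u.
Proof.
move=> [_ fE] dfE; apply/rowP => i; rewrite mxE fE dfE dotE.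
by rewrite trmx_delta -colE !mxE.
Qed.

Lemma jacobian_unique (R : realType) (n m : nat) (f df : 'rV[R]_n -> 'rV[R]_m)
    x (A : 'M[R]_(n, m)) :
  is_diff x f df -> (forall v, df v = v *m A) -> 'J f x = A.
Proof.
move=> [_ fE] dfE; apply/row_matrixP => i.
by rewrite !rowE -diffEjacobian fE dfE.
Qed.

Lemma is_diff_mulmxr (R : realType) (n m : nat) (A : 'M[R]_(n, m))
    (x : 'rV[R]_n) :
  is_diff x (mulmxr A) (mulmxr A).
Proof.
have cA : continuous (mulmxr A : 'rV[R]_n -> 'rV[R]_m).
  apply: bounded_linear_continuous; apply/linear_boundedP.
  near=> r => v /=; rewrite (le_trans (mulmx_norm_le _ _))//.
  rewrite mulrAC ler_wpM2r//.
apply: DiffDef; first exact: linear_differentiable.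
exact: diff_lin.
Unshelve. all: by end_near. Qed.

Lemma is_diff_dot (R : realType) (V : normedModType R) (m : nat)
    (f g df dg : V -> 'rV[R]_m) (x : V) :
    is_diff x f df -> is_diff x g dg ->
  is_diff x (fun y => dot (f y) (g y))
    (fun v => dot (df v) (g x) + dot (f x) (dg v)).
Proof.
move=> [f_diff <-] [g_diff <-].
have -> : (fun y => dot (f y) (g y)) =
    \sum_(i < m) (fun y => f y 0 i) * (fun y => g y 0 i).
  by apply/funext => y; rewrite fct_sumE.
have cd (k : V -> 'rV[R]_m) i : differentiable k x ->
    differentiable (fun y => k y 0 i) x.
  by move=> kd; apply: (@differentiable_comp _ _ _ _ k (fun M => M 0 i)) => //;
    exact: differentiable_coord.
have S_diff :
    differentiable (\sum_(i < m) (fun y => f y 0 i) * (fun y => g y 0 i)) x.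
  by apply: differentiable_sum => i; apply: differentiableM; exact: cd.
have cE (k : V -> 'rV[R]_m) i v : differentiable k x ->
    'D_v (fun y => k y 0 i) x = 'd k x v 0 i.
  move=> kd; have <- : 'D_v k x = 'd k x v by exact: deriveE.
  by rewrite derive_mx ?mxE//; exact: diff_derivable.
apply: DiffDef => //; apply/funext => v.
rewrite -deriveE// derive_sum => [|i]; last first.
  by apply: diff_derivable; apply: differentiableM; exact: cd.
rewrite /dot -big_split/=; apply: eq_bigr => i _.
rewrite deriveM; [|by apply: diff_derivable; exact: cd..].
rewrite (cE _ _ _ f_diff) (cE _ _ _ g_diff) addrC.
by rewrite /GRing.scale/= (mulrC (g x 0 i)).
Qed.

(** * Solutions of the quadratic program *)

Lemma kkt_mapP (R : realType) (n m : nat) (C : set 'rV[R]_n)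
    (f : 'rV[R]_n -> R) (g : 'rV[R]_n -> 'rV[R]_m) z b :
  kkt_map C f g z b <->
  normal_cone C z.1 (b.1 - (grad f z.1 + z.2 *m ('J g z.1)^T)) /\ b.2 = g z.1.
Proof.
split=> [[[u v] [/= Nu ->] <-]|[Nu bg]].
  by rewrite /= addr0 addrAC subrr add0r.
exists (b.1 - (grad f z.1 + z.2 *m ('J g z.1)^T), 0) => //=.
by case: b Nu bg => b1 b2 /= _ ->; congr pair; rewrite ?addr0// addrC subrK.
Qed.

(** For a fixed primal point the optimality conditions are affine in the
    multiplier, up to membership in the convex cone [normal_cone C x]; hence the
    multipliers form a convex set.  This turns local uniqueness of the multiplier
    into global uniqueness. *)
Lemma kkt_segment (R : realType) (n m : nat) (C : set 'rV[R]_n)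
    (f : 'rV[R]_n -> R) (g : 'rV[R]_n -> 'rV[R]_m) x y y' b (t : R) :
    0 <= t <= 1 -> kkt_map C f g (x, y) b -> kkt_map C f g (x, y') b ->
  kkt_map C f g (x, y + t *: (y' - y)) b.
Proof.
move=> /andP[t0 t1] /kkt_mapP[/= [Cx N1] bg] /kkt_mapP[/= [_ N2] _].
apply/kkt_mapP; split=> //=; split=> // x' Cx'.
have -> : b.1 - (grad f x + (y + t *: (y' - y)) *m ('J g x)^T) =
    (1 - t) *: (b.1 - (grad f x + y *m ('J g x)^T)) +
    t *: (b.1 - (grad f x + y' *m ('J g x)^T)).
  rewrite mulmxDl -scalemxAl mulmxBl; apply/rowP => i; rewrite !mxE.
  by set u := \sum_j _; set v := \sum_j _; ring.
rewrite dotDl !dotZl.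
have := N1 _ Cx'; have := N2 _ Cx'; nra.
Qed.

Lemma grad_lagrangianE (R : realType) (n m : nat) (h : 'rV[R]_n -> R)
    (g : 'rV[R]_n -> 'rV[R]_m) x y :
    differentiable h x -> differentiable g x ->
  grad_lagrangian h g (x, y) = grad h x + y *m ('J g x)^T.
Proof.
move=> dh dg.
have hd : is_diff x h ('d h x) by exact: DiffDef.
have gd : is_diff x g ('d g x) by exact: DiffDef.
apply: (grad_unique (is_diffD hd (is_diff_dot gd (is_diff_cst y x)))) => v.
rewrite fctE /= diffEgrad diffEjacobian dot_mulmx_tr dotDl.
by rewrite [dot (g x) _]big1 ?addr0 ?[dot v _]dotC// => i _; rewrite mxE mulr0.
Qed.

Section QuadraticProgram.
Context (R : realType) (n m : nat) (C : set 'rV[R]_n).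
Context (h : 'rV[R]_n -> R) (g : 'rV[R]_n -> 'rV[R]_m).
Context (xk : 'rV[R]_n) (B : 'M[R]_n).
Hypotheses (h_diff : differentiable h xk) (g_diff : differentiable g xk).

Let is_diff_shift (x : 'rV[R]_n) : is_diff x (fun y => y - xk) id.
Proof.
have := is_diffB (is_diff_id x) (is_diff_cst xk x).
by rewrite subr0.
Qed.

Lemma jacobian_qp_constraint x : 'J (qp_constraint g xk) x = 'J g xk.
Proof.
have lin : is_diff (x - xk) ('d g xk) ('d g xk).
  have cg : continuous ('d g xk) by exact: diff_continuous.
  by apply: DiffDef; [exact: linear_differentiable|exact: diff_lin].
have := is_diffD (is_diff_cst (g xk) x) (is_diff_comp (is_diff_shift x) lin).
rewrite add0r => /jacobian_unique; apply => v /=.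
by rewrite diffEjacobian.
Qed.

Lemma grad_qp_objective x : B^T = B ->
  grad (qp_objective h xk B) x = (x - xk) *m B + grad h xk.
Proof.
move=> Bsym.
have lin : is_diff (x - xk) ('d h xk) ('d h xk).
  have ch : continuous ('d h xk) by exact: diff_continuous.
  by apply: DiffDef; [exact: linear_differentiable|exact: diff_lin].
have dB := is_diff_comp (is_diff_shift x) (is_diff_mulmxr B (x - xk)).
have dq := is_diff_dot dB (is_diff_shift x).
have := is_diffD (is_diffZ 2^-1 dq) (is_diff_comp (is_diff_shift x) lin).
move=> /grad_unique; apply => v.
rewrite !fctE /= diffEgrad dotDl; congr (_ + _).
rewrite dot_mulmx_tr Bsym dotC.
by rewrite /GRing.scale/=; field.
Qed.

Lemma qp_objective_expansion x v : B^T = B ->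
  qp_objective h xk B (x + v) = qp_objective h xk B x +
    dot (grad (qp_objective h xk B) x) v + 2^-1 * dot (v *m B) v.
Proof.
move=> Bsym; rewrite grad_qp_objective// /qp_objective addrAC linearD/=.
have vB : dot (v *m B) (x - xk) = dot ((x - xk) *m B) v.
  by rewrite dot_mulmx_tr Bsym dotC.
rewrite mulmxDl !dotDl -diffEgrad.
rewrite (dotDr (x - xk) v ((x - xk) *m B)) (dotDr (x - xk) v (v *m B)) vB.
by field.
Qed.

Lemma qp_constraint_affine x v :
  qp_constraint g xk (x + v) = qp_constraint g xk x + v *m 'J g xk.
Proof. by rewrite /qp_constraint addrAC linearD/= addrA -(diffEjacobian g). Qed.

(** Expand the quadratic objective at [z.1].  Its gradient there is minus a
    normal vector, up to a multiplier term that vanishes on differences of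
    feasible points; hence the first-order term is nonnegative. *)
Lemma kkt_qp_growth z x : spd B ->
    kkt_map C (qp_objective h xk B) (qp_constraint g xk) z 0 ->
    C x -> qp_constraint g xk x = 0 ->
  qp_objective h xk B z.1 + 2^-1 * dot ((x - z.1) *m B) (x - z.1) <=
    qp_objective h xk B x.
Proof.
move=> [Bsym _] /kkt_mapP[/= [Cz Nz] gz] Cx gx.
have := Nz _ Cx; rewrite sub0r dotNl oppr_le0 dotDl jacobian_qp_constraint.
have -> : dot (z.2 *m ('J g xk)^T) (x - z.1) = 0.
  rewrite dotC -dot_mulmx_tr.
  have -> : (x - z.1) *m 'J g xk = 0.
    apply: (@addrI _ (qp_constraint g xk z.1)).
    by rewrite -qp_constraint_affine addrC subrK gx -gz addr0.
  by rewrite /dot big1// => i _; rewrite mxE mul0r.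
rewrite addr0 => ge0.
have := qp_objective_expansion z.1 (x - z.1) Bsym.
rewrite addrC subrK => ->; lra.
Qed.

(** Quadratic growth makes a Karush-Kuhn-Tucker point a minimizer and the only
    one, so any other solution differs from [z] by its multiplier only.  A short
    step from [z] towards it stays in the ball where [z] is the only such point,
    and is again such a point by convexity of the multiplier set. *)
Lemma kkt_qp_unique_solution (zbar z : 'rV[R]_n * 'rV[R]_m) (r : R) : spd B ->
    kkt_map C (qp_objective h xk B) (qp_constraint g xk) z 0 ->
    `|z - zbar| < r ->
    (forall z', `|z' - zbar| <= r ->
       kkt_map C (qp_objective h xk B) (qp_constraint g xk) z' 0 -> z' = z) ->
  unique (primal_dual_solution C (qp_objective h xk B) (qp_constraint g xk)) z.
Proof.
move=> Bspd kz zr locz; have [Bsym Bpos] := Bspd.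
have dotB_ge0 v : 0 <= dot (v *m B) v.
  have [->|v0] := eqVneq v 0; last by rewrite ltW// Bpos.
  by rewrite mul0mx /dot big1// => i _; rewrite mxE mul0r.
split.
  split=> // x Cx gx; apply: le_trans (kkt_qp_growth Bspd kz Cx gx).
  by rewrite lerDl mulr_ge0 ?invr_ge0.
case: z kz zr locz => [x y] kz zr locz [x' y'] [opt kz'].
have /kkt_mapP[/= [Cx _] gx] := kz.
have /kkt_mapP[/= [Cx' _] gx'] := kz'.
(* the quadratic term would make [x'] strictly worse than [x] *)
have ex : x' = x.
  apply/eqP; rewrite -subr_eq0; apply/negP => /negP/Bpos dB.
  have := kkt_qp_growth Bspd kz Cx' (esym gx').
  have := opt _ Cx (esym gx) => /=.
  lra.
rewrite ex in kz' *; congr pair.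
set d := y' - y.
(* a step length keeping [(x, y + t *: d)] within distance [r] of [zbar] *)
pose t := Num.min 1 ((r - `|(x, y) - zbar|) / (`|d| + 1)).
have d1 : 0 < `|d| + 1 by rewrite ltr_wpDl.
have t0 : 0 < t by rewrite lt_min ltr01 divr_gt0// subr_gt0.
have t1 : t <= 1 by rewrite ge_min lexx.
have td : t * `|d| <= r - `|(x, y) - zbar|.
  rewrite (@le_trans _ _ (t * (`|d| + 1)))//.
    by rewrite ler_wpM2l ?(ltW t0)// lerDl.
  by rewrite -ler_pdivlMr// ge_min lexx orbT.
have tr : `|(x, y + t *: d) - zbar| <= r.
  have -> : (x, y + t *: d) - zbar = ((x, y) - zbar) + (0, t *: d).
    by congr pair; rewrite /= ?addr0// addrAC.
  rewrite (le_trans (ler_normD _ _))// -lerBrDl (le_trans _ td)//.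
  rewrite prod_norm_le/= normr0 normrZ gtr0_norm// lexx andbT.
  by rewrite mulr_ge0 ?(ltW t0).
have t01 : 0 <= t <= 1 by rewrite (ltW t0) t1.
have [] := locz _ tr (kkt_segment t01 kz kz').
move=> /(canRL (addKr _)); rewrite addNr => /eqP.
by rewrite scaler_eq0 gt_eqF//= subr_eq0 => /eqP.
Qed.

End QuadraticProgram.

(** * The quasi-Newton step is a local contraction *)

Lemma lipschitz_around_continuous (R : realType) (V W : normedModType R)
    (f : V -> W) (a : V) :
  lipschitz_around f a -> {for a, continuous f}.
Proof.
move=> [U Ua /pinfty_ex_gt0[M M0 lipM]]; apply/cvgrPdist_le => e e0.
near=> x; have Ux : U x by near: x.
apply: le_trans (lipM (a, x) _) _ => /=.
  by split=> //; exact: nbhs_singleton.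
rewrite -ler_pdivlMl// ltW//; near: x; apply: cvgr_dist_lt => //.
by rewrite mulr_gt0 ?invr_gt0.
Unshelve. all: by end_near. Qed.

Lemma near_dist_le (R : realType) (V W : normedModType R) (f : V -> W) (a : V)
    (e : R) :
  {for a, continuous f} -> 0 < e -> \forall x \near a, `|f x - f a| <= e.
Proof. by move=> fa; move: e; apply/cvgrPdistC_le. Qed.

Lemma near_dist_fst_le (R : realType) (V V' W : normedModType R) (f : V -> W)
    (a : V * V') (e : R) :
    {for a.1, continuous f} -> 0 < e ->
  \forall x \near a, `|f x.1 - f a.1| <= e.
Proof.
move=> fa e0; have fst_cvg : fst @ a --> a.1 by exact: cvg_fst.
exact: fst_cvg (near_dist_le fa e0).
Qed.

Lemma dist_le_double (R : realType) (V : normedModType R) (a b c : V) (e : R) :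
  `|a - c| <= e -> `|b - c| <= e -> `|a - b| <= 2 * e.
Proof.
move=> ac bc; rewrite -(subrKA c) (le_trans (ler_normD _ _))//.
by rewrite mulr_natl mulr2n lerD// distrC.
Qed.

Lemma segment_in_ball (R : realType) (V : normedModType R) (x y c : V)
    (r t : R) :
  0 <= t <= 1 -> `|x - c| <= r -> `|y - c| <= r -> `|y + t *: (x - y) - c| <= r.
Proof.
move=> /andP[t0 t1] xr yr.
have -> : y + t *: (x - y) - c = (1 - t) *: (y - c) + t *: (x - c).
  have -> : t *: (x - y) = t *: (x - c) - t *: (y - c).
    by rewrite -scalerBr opprB addrA subrK.
  by rewrite scalerBl scale1r addrAC (addrC (t *: (x - c))) addrA.
rewrite (le_trans (ler_normD _ _))// !normrZ (ger0_norm t0).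
rewrite ger0_norm ?subr_ge0//.
have := ler_wpM2l t0 xr.
have : (1 - t) * `|y - c| <= (1 - t) * r by rewrite ler_wpM2l ?subr_ge0.
lra.
Qed.

Lemma closed_dist_le (R : realType) (V : normedModType R) (c : V) (r : R) :
  closed [set x | `|x - c| <= r].
Proof.
have -> : [set x | `|x - c| <= r] = (fun x => `|x - c|) @^-1` [set t | t <= r].
  by [].
apply: preimage_closed; last exact: closed_le.
move=> x _; apply: cvg_norm; apply: cvgB; first exact: cvg_id.
exact: cvg_cst.
Qed.

(** Changing [x] first, at fixed [y], leaves only the linearization errors of
    [L] and [g]; changing [y] afterwards leaves a bilinear term, which sees [J]
    only through [J z'.1 - J xk].  The factor [n + m] adds the dimension constants
    of the two matrix products. *)
Lemma residual_increment (R : realType) (n m : nat)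
    (p : 'rV[R]_n -> 'rV[R]_n) (g : 'rV[R]_n -> 'rV[R]_m)
    (J : 'rV[R]_n -> 'M[R]_(n, m)) (B : 'M[R]_n) (xk : 'rV[R]_n)
    (z z' : 'rV[R]_n * 'rV[R]_m) (a e : R) :
    let L x y := p x + y *m (J x)^T in
    let E (u : 'rV[R]_n * 'rV[R]_m) :=
      (L u.1 u.2 - L xk u.2 - (u.1 - xk) *m B,
       g u.1 - g xk - (u.1 - xk) *m J xk) in
    (n%:R + m%:R) * a <= e ->
    `|L z.1 z.2 - L z'.1 z.2 - (z.1 - z'.1) *m B| <=
      n%:R * `|z.1 - z'.1| * a ->
    `|g z.1 - g z'.1 - (z.1 - z'.1) *m J xk| <= n%:R * `|z.1 - z'.1| * a ->
    `|J z'.1 - J xk| <= a ->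
  `|E z - E z'| <= e * `|z - z'|.
Proof.
case: z z' => [x y] [x' y'] /= ae Lxx gxx JJ.
have a0 : 0 <= a by exact: le_trans JJ.
set N := `|(x, y) - (x', y')|.
have /andP[xx yy] : (`|x - x'| <= N) && (`|y - y'| <= N).
  by rewrite -(prod_norm_le ((x, y) - (x', y'))).
have N0 : 0 <= N by exact: normr_ge0.
have na_N : n%:R * `|x - x'| * a <= n%:R * a * N.
  by rewrite mulrAC; apply: ler_wpM2l xx; rewrite mulr_ge0.
rewrite prod_norm_le/=; apply/andP; split; last first.
  have -> : g x - g xk - (x - xk) *m J xk -
      (g x' - g xk - (x' - xk) *m J xk) = g x - g x' - (x - x') *m J xk.
    have regroup (b c d q r s : 'rV[R]_m) :
        b - c - (q - r) - (d - c - (s - r)) = b - d - (q - s).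
      by apply/rowP => i; rewrite !mxE; ring.
    by rewrite !mulmxBl regroup.
  apply: le_trans gxx (le_trans na_N _); apply: ler_wpM2r => //.
  by apply: le_trans ae; rewrite ler_wpM2r// lerDl.
(* change [x] with [y] fixed, then change [y] at [x'] *)
have -> : p x + y *m (J x)^T - (p xk + y *m (J xk)^T) - (x - xk) *m B -
    (p x' + y' *m (J x')^T - (p xk + y' *m (J xk)^T) - (x' - xk) *m B) =
    (p x + y *m (J x)^T - (p x' + y *m (J x')^T) - (x - x') *m B) +
    (y - y') *m (J x' - J xk)^T.
  have trB (K K' : 'M[R]_(n, m)) : (K - K')^T = K^T - K'^T by rewrite linearB.
  have regroup (b c d q r s b' c' r' q' f : 'rV[R]_n) :
      b + c - (d + q) - (r - s) - (b' + c' - (d + q') - (r' - s)) =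
      b + c - (b' + f) - (r - r') + (f - q - (c' - q')).
    by apply/rowP => i; rewrite !mxE; ring.
  by rewrite trB !mulmxBl !mulmxBr; exact: regroup.
apply: le_trans (ler_normD _ _) _.
apply: le_trans (lerD (le_trans Lxx na_N) (mulmx_norm_le _ _)) _.
apply: (@le_trans _ _ ((n%:R + m%:R) * a * N)); last exact: ler_wpM2r.
rewrite (mulrDl n%:R) (mulrDl (n%:R * _)) lerD2l mulrAC.
apply: ler_pM; [by rewrite mulr_ge0|by []| |exact: yy].
apply: ler_wpM2l => //; exact: le_trans (mx_norm_trmx _) JJ.
Qed.

Section LocalSolvability.
Context (R : realType) (n m : nat) (C : set 'rV[R]_n).
Context (h : 'rV[R]_n -> R) (g : 'rV[R]_n -> 'rV[R]_m).
Context (zbar : 'rV[R]_n * 'rV[R]_m).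
Hypotheses (h_diff : forall x, differentiable h x)
  (g_diff : forall x, differentiable g x).

(** The value at [z] of the single-valued part of the optimality system of the
    original program minus that of the quadratic program built from the state
    [w].  It vanishes when [z.1] is the current iterate. *)
Definition qn_residual (w : ('rV[R]_n * 'rV[R]_m) * 'M[R]_n)
    (z : 'rV[R]_n * 'rV[R]_m) : 'rV[R]_n * 'rV[R]_m :=
  (grad_lagrangian h g z - grad_lagrangian h g (w.1.1, z.2) -
     (z.1 - w.1.1) *m w.2,
   g z.1 - g w.1.1 - (z.1 - w.1.1) *m 'J g w.1.1).

(** Both optimality systems contain the same normal cone, so the quadratic
    program is a perturbation of the original one by a function. *)
Lemma kkt_qp_residual w z : w.2^T = w.2 ->
  kkt_map C (qp_objective h w.1.1 w.2) (qp_constraint g w.1.1) z 0 <->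
  kkt_map C h g z (0 + qn_residual w z).
Proof.
move=> Bsym; case: z => x y.
rewrite add0r !kkt_mapP add0r /= grad_qp_objective// jacobian_qp_constraint//.
rewrite !grad_lagrangianE//= /qp_constraint diffEjacobian.
have cancel (p q r : 'rV[R]_n) : p - q - r - p = - (r + q).
  by rewrite addrAC (addrAC p) subrr sub0r -opprD addrC.
rewrite cancel addrA -(addrA (g x)) -opprD.
split=> -[Nz gz]; split=> //; first by rewrite -gz subr0.
by move: gz; rewrite -[X in _ = X]subr0 => /addrI/oppr_inj.
Qed.

Hypotheses (g_C1 : continuous (fun x => 'J g x))
  (L_hess : \forall z \near zbar,
     differentiable (fun x => grad_lagrangian h g (x, z.2)) z.1)
  (L_cont : {for zbar, continuous (hess_lagrangian h g)}).

Lemma qn_residualE w z : qn_residual w z =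
  (grad h z.1 + z.2 *m ('J g z.1)^T -
     (grad h w.1.1 + z.2 *m ('J g w.1.1)^T) - (z.1 - w.1.1) *m w.2,
   g z.1 - g w.1.1 - (z.1 - w.1.1) *m 'J g w.1.1).
Proof.
by case: z => x y; rewrite /qn_residual !grad_lagrangianE.
Qed.

(** In [x], the residual has derivative (Hessian of the Lagrangian minus [w.2],
    ['J g x] minus ['J g] at the current iterate), and in [y] it is affine with
    slope a difference of two values of ['J g].  All of these are small
    near the reference point, so the mean value inequality makes the Lipschitz
    constant of the residual as small as desired. *)
Lemma qn_residual_lipschitz (e : R) : 0 < e ->
  exists2 r, 0 < r & forall w, `|w - (zbar, hess_lagrangian h g zbar)| < r ->
    forall z z', `|z - zbar| <= r -> `|z' - zbar| <= r ->
      `|qn_residual w z - qn_residual w z'| <= e * `|z - z'|.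
Proof.
move=> e0; set H := hess_lagrangian h g zbar.
have [e1 e10 ce1] : exists2 e1 : R, 0 < e1 & (n%:R + m%:R) * (2 * e1) <= e.
  (* the added 1 keeps [c] positive if [n = m = 0] *)
  pose c : R := (n%:R + m%:R) * 2 + 1.
  have c0 : 0 < c by rewrite ltr_wpDl// mulr_ge0// addr_ge0.
  exists (e / c); first by rewrite divr_gt0.
  by rewrite mulrA mulrA ler_pdivrMr// mulrC ler_pM2l// lerDl.
have near_zbar : \forall z \near zbar,
    [/\ differentiable (fun x => grad_lagrangian h g (x, z.2)) z.1,
        `|hess_lagrangian h g z - H| <= e1 & `|'J g z.1 - 'J g zbar.1| <= e1].
  have Hc := near_dist_le L_cont e10.
  have Jc := near_dist_fst_le (f := fun x => 'J g x) (g_C1 (x := zbar.1)) e10.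
  by apply: filterS3 L_hess Hc Jc => z z1 z2 z3; split.
have [r1 /= r10 Pr1] := (nbhs_normP _ _).1 near_zbar.
pose r := Num.min (r1 / 2) e1.
have r0 : 0 < r by rewrite lt_min e10 divr_gt0.
have {}Pr1 z : `|z - zbar| <= r ->
    [/\ differentiable (fun x => grad_lagrangian h g (x, z.2)) z.1,
        `|hess_lagrangian h g z - H| <= e1 & `|'J g z.1 - 'J g zbar.1| <= e1].
  move=> zr; apply: Pr1 => /=; rewrite distrC (le_lt_trans zr)// /r gt_min.
  by rewrite ltr_pdivrMr// ltr_pMr// ltr1n.
exists r => // w wr z z' zr z'r.
move: wr; rewrite prod_norm_lt/= prod_norm_lt/= => /andP[/andP[xkr _] Br].
have {}Br : `|w.2 - H| <= e1.
  by rewrite ltW// (lt_le_trans Br)// ge_min lexx orbT.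
set xk := w.1.1 in xkr *.
have ballx (x : 'rV[R]_n) (y : 'rV[R]_m) : `|x - zbar.1| <= r ->
    `|y - zbar.2| <= r -> `|(x, y) - zbar| <= r.
  by move=> xr yr; rewrite prod_norm_le/= xr.
have zz (u : 'rV[R]_n * 'rV[R]_m) : `|u - zbar| <= r ->
    `|u.1 - zbar.1| <= r /\ `|u.2 - zbar.2| <= r.
  by rewrite prod_norm_le/= => /andP[].
have [xr yr] := zz _ zr; have [x'r y'r] := zz _ z'r.
have J2 x x' : `|x - zbar.1| <= r -> `|x' - zbar.1| <= r ->
    `|'J g x - 'J g x'| <= 2 * e1.
  move=> ar br; have zb0 : `|zbar.2 - zbar.2| <= r by rewrite subrr normr0 ltW.
  have [_ _ /= aJ] := Pr1 _ (ballx _ _ ar zb0).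
  have [_ _ /= bJ] := Pr1 _ (ballx _ _ br zb0).
  exact: dist_le_double aJ bJ.
have L_incr :
    `|grad_lagrangian h g (z.1, z.2) - grad_lagrangian h g (z'.1, z.2) -
      (z.1 - z'.1) *m w.2| <= n%:R * `|z.1 - z'.1| * (2 * e1).
  apply: (jacobian_mean_value (f := fun x => grad_lagrangian h g (x, z.2))).
  move=> t t01.
  have [/= df hess _] := Pr1 _ (ballx _ _ (segment_in_ball t01 xr x'r) yr).
  by split; [exact: df|exact: dist_le_double hess Br].
rewrite (grad_lagrangianE z.2 (h_diff z.1) (g_diff z.1)) in L_incr.
rewrite (grad_lagrangianE z.2 (h_diff z'.1) (g_diff z'.1)) in L_incr.
rewrite !qn_residualE; apply: (residual_increment ce1).
- exact: L_incr.
- apply: jacobian_mean_value => t t01; split; first exact: g_diff.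
  exact: J2 (segment_in_ball t01 xr x'r) (ltW xkr).
- exact: J2 x'r (ltW xkr).
Qed.

(** Take the residual as the perturbation of the strongly regular optimality
    system.  Since it vanishes at [(w.1.1, zbar.2)] and has a small Lipschitz
    constant, its size at [zbar] is a small multiple of [`|w.1.1 - zbar.1|]; the
    distance bound for perturbed solutions then gives the contraction.  The
    constant [1 / (4 k)] yields the factor 1/2. *)
Lemma qn_step_solvable :
    strongly_regular (kkt_map C h g) zbar 0 ->
  exists2 r, 0 < r & forall w, spd w.2 ->
    `|w - (zbar, hess_lagrangian h g zbar)| < r ->
    exists2 z, unique (primal_dual_solution C (qp_objective h w.1.1 w.2)
        (qp_constraint g w.1.1)) z &
      `|z - zbar| <= 2^-1 * `|w.1 - zbar|.
Proof.
move=> reg.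
have ball_compact (r : R) : compact [set z | `|z - zbar| <= r].
  rewrite (_ : mkset _ = [set x | `|x - zbar.1| <= r] `*`
                         [set y | `|y - zbar.2| <= r]); last first.
    by apply/seteqP; split=> z /=; rewrite prod_norm_le/= => /andP.
  have rV_ball p (c : 'rV[R]_p) : compact [set x | `|x - c| <= r].
    apply: bounded_closed_compact.
      exists (r + `|c|); split=> [|M rM x /= xr]; first exact: num_real.
      apply: le_trans (ltW rM).
      by rewrite -[x](subrK c) (le_trans (ler_normD _ _))// lerD2r.
    exact: closed_dist_le.
  by apply: compact_setX.
have [k k0 [r0 r00 solve]] := strongly_regular_perturbation ball_compact reg.
have k4 : 0 < (4 * k)^-1 by rewrite invr_gt0 mulr_gt0.
have [r1 r10 lip] := qn_residual_lipschitz k4.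
pose r := Num.min r0 r1.
have rpos : 0 < r by rewrite lt_min r00.
have rr1 : r <= r1 by rewrite ge_min lexx orbT.
exists r => // w Bspd wr; have [Bsym _] := Bspd.
have wr1 := lt_le_trans wr rr1.
move: wr; rewrite prod_norm_lt => /andP[/= zkr _].
have xkr : `|w.1.1 - zbar.1| < r by move: zkr; rewrite prod_norm_lt => /andP[].
have res_xk : qn_residual w (w.1.1, zbar.2) = 0.
  by rewrite /qn_residual/= !subrr !mul0mx !subr0.
have dxk : `|zbar - (w.1.1, zbar.2)| = `|w.1.1 - zbar.1|.
  by rewrite prod_normE/= subrr normr0 distrC max_l.
have Ezbar : `|qn_residual w zbar| <= (4 * k)^-1 * `|w.1.1 - zbar.1|.
  rewrite -dxk -[X in `|X|]subr0 -res_xk; apply: lip => //.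
    by rewrite subrr normr0 ltW.
  by rewrite distrC dxk ltW// (lt_le_trans xkr).
have Ek : 2 * k * `|qn_residual w zbar| <= 2^-1 * `|w.1.1 - zbar.1|.
  have -> : 2^-1 * `|w.1.1 - zbar.1| = 2 * k * ((4 * k)^-1 * `|w.1.1 - zbar.1|).
    by field; rewrite gt_eqF.
  by rewrite ler_pM2l// mulr_gt0.
have Er : 2 * k * `|qn_residual w zbar| < r.
  rewrite (le_lt_trans Ek)// (le_lt_trans _ xkr)// ler_piMl// invf_le1//.
  by rewrite ler1n.
have [||z [zE kz uz]] := solve r (qn_residual w) _ _ (ltW Er).
- by rewrite rpos ge_min lexx.
- move=> z z' zr z'r; apply: le_trans (lip _ wr1 _ _ _ _) _;
    [exact: le_trans rr1|exact: le_trans rr1|].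
  rewrite ler_wpM2r// lef_pV2 ?posrE ?mulr_gt0// ler_pM2r//.
  by rewrite ler_nat.
exists z.
  apply: (kkt_qp_unique_solution (h_diff _) (g_diff _) Bspd _ (r := r)).
  - exact: (kkt_qp_residual z Bsym).2 kz.
  - exact: le_lt_trans zE Er.
  - move=> z' z'r kz'; apply: uz => //.
    exact: (kkt_qp_residual z' Bsym).1 kz'.
apply: le_trans zE (le_trans Ek _); rewrite ler_pM2l ?invr_gt0//.
by have := lexx `|w.1 - zbar|; rewrite prod_norm_le/= => /andP[].
Qed.

End LocalSolvability.


(** * Comparison functions and input-to-state stability *)

Lemma class_K_le (R : realType) (a : R -> R) s t :
  class_K a -> 0 <= s -> s <= t -> a s <= a t.
Proof.
move=> [_ a_mono _] s0; rewrite le_eqVlt => /predU1P[->//|st].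
by rewrite ltW// a_mono// in_itv/= andbT// (le_trans s0)// ltW.
Qed.

Lemma class_K_small (R : realType) (a : R -> R) (e : R) :
  class_K a -> 0 < e -> exists2 d, 0 < d & forall s, 0 <= s <= d -> a s < e.
Proof.
move=> Ka e0; have [ac _ a0] := Ka.
have [_ a_right] := (continuous_within_itvcyP _ _).1 ac.
have : \forall d \near 0^'+, 0 < d /\ a d < e.
  near=> d; split; first by near: d; exact: nbhs_right_gt.
  by near: d; apply: cvgr_lt a_right _ _; rewrite a0.
move=> /filter_ex[d [d0 ad]]; exists d => // s /andP[s0 sd].
exact: le_lt_trans (class_K_le Ka s0 sd) ad.
Unshelve. all: by end_near. Qed.

(** Input-to-state stability is a statement about infinite input sequences.  To
    use it inside an induction, where the inputs are under control only up to
    time [N], the inputs are replaced by 0 from [N] on; the state at time [N]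
    does not see the difference.  Monotonicity of the gain allows any bound [s]
    on the inputs in place of their supremum. *)
Lemma ISS_finite_horizon (R : realType) (W U : normedModType R) (D : set W)
    (Phi : W -> U -> W) (wbar : W) :
    locally_ISS D Phi wbar ->
  exists (e d : R) (b : R -> R -> R) (c : R -> R),
    [/\ 0 < e, 0 < d, class_KL b, class_Koo c &
      forall (w : nat -> W) (u : nat -> U) (s : R) (N : nat),
        D (w 0%N) -> (forall k, (k < N)%N -> w k.+1 = Phi (w k) (u k)) ->
        `|w 0%N - wbar| < e ->
        0 <= s < d -> (forall k, (k < N)%N -> `|u k| <= s) ->
        `|w N - wbar| <= b `|w 0%N - wbar| N%:R + c s].
Proof.
move=> [e [d [b [c [e0 d0 bKL cK iss]]]]]; exists e, d, b, c; split=> //.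
move=> w u s N Dw0 wu w0e /andP[s0 sd] us.
pose u' k := if (k < N)%N then u k else 0.
pose w' := fix F k := if k is k'.+1 then Phi (F k') (u' k') else w 0%N.
have u's k : `|u' k| <= s.
  by rewrite /u'; case: ifPn => [/us//|_]; rewrite normr0.
have u's_ub : ubound (range (fun k => `|u' k|)) s by move=> _ [k _ <-].
have sup_s : sup_norm u' <= s.
  by apply: ge_sup => //; exists `|u' 0%N|, 0%N.
have sup0 : 0 <= sup_norm u'.
  apply: (le_trans (normr_ge0 (u' 0%N))).
  by apply: ub_le_sup; [exists s|exists 0%N].
have ww' k : (k <= N)%N -> w' k = w k.
  elim: k => [//|k IH kN]; rewrite /= IH 1?ltnW// wu// /u' kN//.
rewrite -ww'//.
apply: le_trans (iss w' u' Dw0 (fun _ => erefl) w0e _ _ N) _.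
- by exists s.
- exact: le_lt_trans sd.
- by rewrite lerD2l; case: cK => cK _; exact: class_K_le.
Qed.

(** * Feedback of a contraction with an input-to-state stable system *)

Section Cascade.
Context (R : realType) (Z M : normedModType R) (D : set M) (Psi : M -> Z -> M).
Context (zbar : Z) (H : M).
Hypothesis PsiD : forall B z, D B -> D (Psi B z).
Hypothesis PsiISS : locally_ISS D (fun B u => Psi B (zbar + u)) H.

(** The two subsystems feed each other: [z] contracts while [B] is close to [H],
    and [B] stays close to [H] while [z] is close to [zbar].  Joint induction on
    time closes the loop: contraction up to time [k] bounds all the inputs
    received by [B] up to then by [d], and [d] is small enough for the stability
    estimate to keep [B] within the region of contraction. *)
Lemma cascade_confined (r E : R) : 0 < r -> 0 < E ->
  exists2 d, 0 < d & forall w : nat -> Z * M,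
    D (w 0%N).2 -> (forall k, (w k.+1).2 = Psi (w k).2 (w k.+1).1) ->
    (forall k, `|w k - (zbar, H)| < r ->
       `|(w k.+1).1 - zbar| <= 2^-1 * `|(w k).1 - zbar|) ->
    `|w 0%N - (zbar, H)| < d ->
    forall k, `|w k - (zbar, H)| < E /\ `|(w k).1 - zbar| <= 2^-1 ^+ k * d.
Proof.
move=> r0 E0.
have [e [d0 [b [c [e0 d00 bKL [cK _] iss]]]]] := ISS_finite_horizon PsiISS.
have [eta [eta0 eta_r eta_E]] : exists eta : R,
    [/\ 0 < eta, eta <= r & eta <= E].
  by exists (Num.min r E); rewrite lt_min r0 E0 !ge_min !lexx orbT.
have eta2 : 0 < eta / 2 by rewrite divr_gt0.
have [db db0 b_small] := class_K_small (bKL.1 0 (lexx _)) eta2.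
have [dc dc0 c_small] := class_K_small cK eta2.
have [d dpos [d_eta d_e d_d0 d_db d_dc]] : exists2 d : R, 0 < d &
    [/\ d <= eta, d <= e, d < d0, d <= db & d <= dc].
  exists (Num.min (Num.min eta e) (Num.min (d0 / 2) (Num.min db dc))).
    by rewrite !lt_min eta0 e0 db0 dc0 divr_gt0.
  have d02 : d0 / 2 < d0 by rewrite ltr_pdivrMr// ltr_pMr// ltr1n.
  by rewrite !(ge_min, gt_min) !lexx d02 !orbT.
exists d => // w D0 wPsi wcontr w0.
have step k : `|w k - (zbar, H)| < eta ->
    `|(w k.+1).1 - zbar| <= 2^-1 * `|(w k).1 - zbar|.
  by move=> wk; apply: wcontr; rewrite (lt_le_trans wk)// ge_min lexx.
have pow_le k : 2^-1 ^+ k * d <= d.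
  by rewrite ler_piMl ?(ltW dpos)// exprn_ile1// invf_le1// ler1n.
suff main k : forall j, (j <= k)%N ->
    `|w j - (zbar, H)| < eta /\ `|(w j).1 - zbar| <= 2^-1 ^+ j * d.
  move=> k; have [wk zk] := main k k (leqnn _).
  by split=> //; exact: lt_le_trans wk _.
elim: k => [j|k IH j].
  rewrite leqn0 => /eqP ->; rewrite expr0 mul1r; split.
    exact: lt_le_trans w0 _.
  by move: w0; rewrite prod_norm_lt/= => /andP[/ltW].
rewrite leq_eqVlt => /predU1P[->{j}|]; last exact: IH.
have zk j : (j <= k.+1)%N -> `|(w j).1 - zbar| <= 2^-1 ^+ j * d.
  case: j => [_|j jk]; first by have [] := IH 0%N.
  have [wj zj] := IH j jk.
  by rewrite (le_trans (step _ wj))// exprS -mulrA ler_pM2l// invr_gt0.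
split; last exact: zk.
have [wk _] := IH k (leqnn k).
rewrite prod_norm_lt/=; apply/andP; split.
  have zk_eta : `|(w k).1 - zbar| < eta.
    by move: wk; rewrite prod_norm_lt => /andP[].
  apply: le_lt_trans (step _ wk) (le_lt_trans _ zk_eta).
  by rewrite ler_piMl// invf_le1// ler1n.
have w02 : `|(w 0%N).2 - H| < d by move: w0; rewrite prod_norm_lt => /andP[].
have := iss (fun j => (w j).2) (fun j => (w j.+1).1 - zbar) d k.+1 D0.
have b0 : b `|(w 0%N).2 - H| k.+1%:R < eta / 2.
  apply: le_lt_trans (b_small `|(w 0%N).2 - H| _).
    by apply: (bKL.2 _ (normr_ge0 _)).1; rewrite ?in_itv/= ?lexx ?ler0n.
  by rewrite normr_ge0 (le_trans (ltW w02)).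
move=> /(_ _ _ _ _)/le_lt_trans; apply.
- by move=> j _; rewrite addrC subrK wPsi.
- exact: lt_le_trans w02 _.
- by rewrite (ltW dpos).
- move=> j jk; apply: le_trans (zk j.+1 _) _ => //.
rewrite [ltRHS](splitr eta) ltrD//.
by rewrite c_small// (ltW dpos).
Qed.

(** Confinement gives stability, and also continuation: a state that never
    leaves the region where the step is possible starts a trajectory.  For
    attractivity, [z] converges geometrically; restarting the estimate for [B]
    at a late time [K] makes the gain term small, and the transient term then
    decays, uniformly because the state at time [K] is confined. *)
Lemma cascade_asymptotically_stable (step : Z * M -> Z * M -> Prop) (r : R) :
    0 < r ->
    (forall w w', step w w' -> w'.2 = Psi w.2 w'.1) ->
    (forall w w', D w.2 -> `|w - (zbar, H)| < r -> step w w' ->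
       `|w'.1 - zbar| <= 2^-1 * `|w.1 - zbar|) ->
    (forall w, D w.2 -> `|w - (zbar, H)| < r -> exists w', step w w') ->
  locally_asymptotically_stable [set w | D w.2] step (zbar, H).
Proof.
move=> r0 stepPsi step_contr step_ex.
have trajP w : trajectory [set w | D w.2] step w ->
  [/\ D (w 0%N).2, forall k, (w k.+1).2 = Psi (w k).2 (w k.+1).1 &
    forall k, `|w k - (zbar, H)| < r ->
       `|(w k.+1).1 - zbar| <= 2^-1 * `|(w k).1 - zbar|].
  by move=> [Dw sw]; split=> [|k|k wk]; [exact: Dw|exact: stepPsi|
     apply: step_contr wk _ => //; exact: Dw].
split.
- have [d d0 stay] := cascade_confined r0 r0.
  exists d => // w0 Dw0 w0d.
  (* where the step cannot be performed the extension is arbitrary, so that a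
     total successor function exists *)
  have [next nextP] : {next : Z * M -> Z * M & forall w,
      (next w).2 = Psi w.2 (next w).1 /\
      ((exists w', step w w') -> step w (next w))}.
    apply: (@choice _ _ (fun w v => v.2 = Psi w.2 v.1 /\
      ((exists w', step w w') -> step w v))) => w.
    have [[w' sw]|nsw] := pselect (exists w', step w w').
      by exists w'; split=> // ; exact: stepPsi.
    by exists (zbar, Psi w.2 zbar); split.
  pose w k := iter k next w0.
  have Dw k : D (w k).2.
    by elim: k => [//|k IH] /=; rewrite (nextP _).1; exact: PsiD.
  have near_w k : `|w k - (zbar, H)| < r.
    apply: (stay w _ _ _ _ k).1 => //.
    - by move=> j; rewrite /= (nextP _).1.
    - move=> j wj; apply: (step_contr _ _ (Dw j) wj).
      by apply: (nextP _).2; exact: step_ex.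
  exists w => //; split=> k; first exact: Dw.
  by apply: (nextP _).2; exact: step_ex.
- move=> e e0; have [d d0 stay] := cascade_confined r0 e0.
  exists d => // w /trajP[D0 wPsi wc] w0 k.
  by have [] := stay w D0 wPsi wc w0 k.
- have [e [u0 [b [c [e0 u00 bKL [cK _] iss]]]]] := ISS_finite_horizon PsiISS.
  have [d d0 stay] := cascade_confined r0 e0.
  exists d => // w wtraj w0.
  have [D0 wPsi wc] := trajP _ wtraj; have [Dw _] := wtraj.
  have {}stay := stay w D0 wPsi wc w0.
  have pow0 : (fun k : nat => 2^-1 ^+ k * d) @ \oo --> 0.
    rewrite -(mul0r d); apply: cvgMl.
    by apply: cvg_expr; rewrite gtr0_norm ?invr_gt0// invf_lt1// ltr1n.
  apply/cvgrPdist_lt => eps eps0.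
  have eps2 : 0 < eps / 2 by rewrite divr_gt0.
  have [dc dc0 c_small] := class_K_small cK eps2.
  have m0 : 0 < Num.min (u0 / 2) dc by rewrite lt_min dc0 divr_gt0.
  have [K _ Ksmall] := cvgr_lt _ pow0 _ m0.
  have sK0 : 0 <= 2^-1 ^+ K * d by rewrite mulr_ge0 ?exprn_ge0 ?invr_ge0// ltW.
  have sK := Ksmall K (leqnn K); rewrite lt_min in sK.
  have /andP[sKu sKc] := sK.
  have b_small : \forall t \near +oo, b e t < eps / 2.
    exact: cvgr_lt _ ((bKL.2 e (ltW e0)).2) _ eps2.
  have [J _ Jsmall] : \forall j \near \oo, b e j%:R < eps / 2.
    exact: (@cvgr_idn R) _ b_small.
  near=> k.
  have KJk : (K + J <= k)%N by near: k; exact: nbhs_infty_ge.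
  rewrite distrC prod_norm_lt; apply/andP; split=> /=.
    apply: le_lt_trans (stay k).2 _.
    by near: k; exact: cvgr_lt _ pow0 _ eps0.
  have Kk : (K <= k)%N by rewrite (leq_trans _ KJk)// leq_addr.
  have wKe : `|(w K).2 - H| < e.
    by have [] := stay K; rewrite prod_norm_lt => /andP[].
  have -> : w k = w (K + (k - K))%N by rewrite subnKC.
  have := iss (fun j => (w (K + j)%N).2) (fun j => (w (K + j.+1)%N).1 - zbar)
    (2^-1 ^+ K * d) (k - K)%N.
  rewrite addn0 => issK; apply: le_lt_trans (issK (Dw K) _ wKe _ _) _.
  - by move=> j _; rewrite addrC subrK addnS wPsi.
  - rewrite sK0 (lt_le_trans sKu)// ler_pdivrMr// ler_peMr ?(ltW u00)//.
    by rewrite ler1n.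
  - move=> j _; apply: le_trans (stay _).2 _.
    rewrite ler_pM2r// ler_wiXn2l ?invr_ge0 ?leq_addr//.
    by rewrite invf_le1// ler1n.
  rewrite [ltRHS]splitr ltrD//; last by rewrite c_small// sK0 ltW.
  apply: le_lt_trans (Jsmall (k - K)%N _); last by rewrite /= leq_subRL.
  by apply: class_K_le (bKL.1 _ _) _ _; rewrite ?ler0n// ltW.
Unshelve. all: by end_near. Qed.

End Cascade.

(** * Stability of the quasi-Newton method *)

Unset Implicit Arguments.

Theorem proposition3 (R : realType) (n m : nat) (C : set 'rV[R]_n)
  (h : 'rV[R]_n -> R) (g : 'rV[R]_n -> 'rV[R]_m)
  (Psi : 'M[R]_n -> 'rV[R]_n * 'rV[R]_m -> 'M[R]_n)
  (zbar : 'rV[R]_n * 'rV[R]_m)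
  (C_closed : closed C) (C_convex : convex_set C)
  (h_diff : forall x, differentiable h x) (h_C1 : continuous (grad h))
  (g_diff : forall x, differentiable g x)
  (g_C1 : continuous (fun x => 'J g x))
  (h_lip : lipschitz_around (grad h) zbar.1)
  (g_lip : lipschitz_around (fun x => 'J g x) zbar.1)
  (L_hess : \forall z \near zbar,
     differentiable (fun x => grad_lagrangian h g (x, z.2)) z.1)
  (L_lip : lipschitz_around (hess_lagrangian h g) zbar)
  (zbar_sol : primal_dual_solution C h g zbar)
  (zbar_reg : strongly_regular (kkt_map C h g) zbar 0)
  (Psi_spd : forall B z, spd B -> spd (Psi B z))
  (Psi_ISS : locally_ISS (@spd R n) (fun B u => Psi B (zbar + u))
     (hess_lagrangian h g zbar)) :
  locally_asymptotically_stable [set w | spd w.2]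
    (quasi_newton_step C h g Psi) (zbar, hess_lagrangian h g zbar).
Proof.
have [r r0 solve] := qn_step_solvable h_diff g_diff g_C1 L_hess
  (lipschitz_around_continuous L_lip) zbar_reg.
apply: (cascade_asymptotically_stable Psi_spd Psi_ISS r0) => [w w' []//| |].
- move=> w w' Bspd wr [[sol' _] _].
  by have [z [_ uniq_z] zr] := solve w Bspd wr; rewrite -(uniq_z _ sol').
- move=> w Bspd wr; have [z sol_z _] := solve w Bspd wr.
  by exists (z, Psi w.2 z).
Qed.
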